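(* Let $b:\mathbb{R}\to\mathbb{R}$ be a bounded Borel function, $n\in\mathbb{N}$, $n\ge1$, $t>0$, and set $$I_{n,1}(t)=\int_0^t ds_1\int_{s_1}^t ds_2\cdots\int_{s_{n-1}}^t ds_n\int_{\mathbb{R}^n}b(y_1)\cdots b(y_n)\,\prod_{i=1}^n q'_{s_i-s_{i-1}}(y_i-y_{i-1})\,dy_1\cdots dy_n,$$ with $s_0=0$, $y_0=0$. Then $$|I_{n,1}(t)|\le\frac{(2\sqrt{\pi})^n}{(\sqrt{e})^n\,[n/2]!}\,\|b\|_\infty^n\,t^{n/2}.$$
   Context: $q_t(x)=\frac{e^{-x^2/(2t)}}{\sqrt{2\pi t}}$ for $t>0$, $x\in\mathbb{R}$, is the heat kernel and $q_t'$ is its derivative with respect to $x$. $[n/2]$ is the integer part of $n/2$. *)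

(* Defs.v *)
From HB Require Import structures.
From mathcomp Require Import all_boot all_order all_algebra.
From mathcomp Require Import all_classical all_reals all_analysis.

Set Implicit Arguments.
Unset Strict Implicit.
Unset Printing Implicit Defensive.

Import Order.TTheory GRing.Theory Num.Theory.
Import numFieldNormedType.Exports.

Local Open Scope classical_set_scope.
Local Open Scope ring_scope.

Definition heat_kernel (R : realType) (t x : R) : R :=
  expR (- (x ^+ 2 / (2 * t))) / Num.sqrt (2 * pi * t).

Definition sup_norm (R : realType) (b : R -> R) : R :=
  sup (range (fun x => `|b x|)).

(* Lebesgue measure on R^n, as an n-fold product measure: the coordinate y_1
   is the head of the tuple. *)
Fixpoint lebesgue_tuple (R : realType) (n : nat) :
    set (n.-tuple (measurableTypeR R)) -> \bar R :=
  if n is m.+1 then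
    pushforward (lebesgue_measure \x @lebesgue_tuple R m)%E
      (fun p => [tuple of p.1 :: p.2])
  else \d_ ([tuple] : 0.-tuple (measurableTypeR R)).
Arguments lebesgue_tuple : clear implicits.

Section lebesgue_tuple.
Context {R : realType}.
Local Notation RR := (measurableTypeR R).
Local Open Scope ereal_scope.

Let cons_tuple m (p : RR * m.-tuple RR) : m.+1.-tuple RR :=
  [tuple of p.1 :: p.2].

Let measurable_cons_tuple m : measurable_fun setT (@cons_tuple m).
Proof. exact: measurable_cons. Qed.

Let box_cons m (A : 'I_m.+1 -> set RR) :
  (@cons_tuple m) @^-1` [set y | forall i, A i (tnth y i)] =
  A ord0 `*` [set y | forall i, A (lift ord0 i) (tnth y i)].
Proof.
apply/seteqP; split => -[x y] /= => [Axy|[Ax Ay] i].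
  split=> [|i]; first exact: (Axy ord0).
  by have := Axy (lift ord0 i); rewrite tnthS.
by case: (unliftP ord0 i) => [j|] ->//; rewrite tnthS.
Qed.

Let measurable_box m (A : 'I_m -> set RR) : (forall i, measurable (A i)) ->
  measurable [set y : m.-tuple RR | forall i, A i (tnth y i)].
Proof.
move=> mA; rewrite (_ : [set _ | _] =
    \bigcap_(i in [set: 'I_m]) (fun y : m.-tuple RR => tnth y i) @^-1` A i).
  apply: fin_bigcap_measurable; first exact: finite_finset.
  by move=> i _; rewrite -[_ @^-1` _]setTI; exact: measurable_tnth.
by apply/seteqP; split => y /= Ay i; [move=> _; exact: Ay|exact: Ay].
Qed.

Section step.
Variables (m : nat) (mu : {sigma_finite_measure set (m.-tuple RR) -> \bar R}).

Let nu := pushforward (lebesgue_measure \x mu) (@cons_tuple m).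

Let nu0 : nu set0 = 0.
Proof. by rewrite /nu /pushforward preimage_set0 measure0. Qed.

Let nu_ge0 A : 0 <= nu A. Proof. by rewrite /nu /pushforward measure_ge0. Qed.

Let nu_sigma_additive : semi_sigma_additive nu.
Proof.
have mf := @measurable_cons_tuple m.
pose p := measure_function_pushforward__canonical__measure_function_Measure
  (lebesgue_measure \x mu) mf.
exact: (@measure_semi_sigma_additive _ _ _ p).
Qed.

HB.instance Definition _ :=
  isMeasure.Build _ _ _ nu nu0 nu_ge0 nu_sigma_additive.

Let nu_sigma_finite : sigma_finite setT nu.
Proof.
have /sigma_finiteP[F [TF ndF Foo]] := sigma_finiteT (@lebesgue_measure R).
have /sigma_finiteP[G [TG ndG Goo]] := sigma_finiteT mu.
pose g (y : m.+1.-tuple RR) : RR * m.-tuple RR :=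
  (tnth y ord0, [tuple of behead y]).
have gK p : g (cons_tuple p) = p by case: p => x y; congr pair; apply/val_inj.
have mg : measurable_fun setT g.
  by apply: measurable_fun_pair;
    [exact: measurable_tnth|exact: measurable_behead].
have FGT : \bigcup_k (F k `*` G k) = setT.
  rewrite -setXTT TF TG predeqE => -[x y]; split.
    by move=> [k _ []/= ? ?]; split; exists k.
  move=> [/= [i _ Fx] [j _ Gy]]; exists (maxn i j) => //; split.
  - by move: x Fx; exact/subsetPset/ndF/leq_maxl.
  - by move: y Gy; exact/subsetPset/ndG/leq_maxr.
exists (fun k => g @^-1` (F k `*` G k)).
  by rewrite -preimage_bigcup FGT preimage_setT.
move=> k; have [mFk Fk] := Foo k; have [mGk Gk] := Goo k.
split; first by rewrite -[_ @^-1` _]setTI; apply: mg => //; exact: measurableX.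
rewrite /nu /pushforward (_ : _ @^-1` _ = F k `*` G k); last first.
  by rewrite -comp_preimage (_ : g \o _ = id) ?preimage_id//; exact/funext.
by rewrite product_measure1E// lte_mul_pinfty// ge0_fin_numE.
Qed.

HB.instance Definition _ :=
  Measure_isSigmaFinite.Build _ _ _ nu nu_sigma_finite.

Lemma pushforward_cons_sigma_finite :
  exists mu' : {sigma_finite_measure set (m.+1.-tuple RR) -> \bar R}, nu = mu'.
Proof. by exists nu. Qed.

End step.

Let lebesgue_tuple_exists n :
  exists mu : {sigma_finite_measure set (n.-tuple RR) -> \bar R},
    lebesgue_tuple R n = mu.
Proof.
elim: n => [|n [mu muE]]; first by eexists (\d_ _).
rewrite /= muE; exact: pushforward_cons_sigma_finite.
Qed.

Let lebesgue_tuple0 n : lebesgue_tuple R n set0 = 0.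
Proof. by have [mu ->] := lebesgue_tuple_exists n; exact: measure0. Qed.

Let lebesgue_tuple_ge0 n A : 0 <= lebesgue_tuple R n A.
Proof. by have [mu ->] := lebesgue_tuple_exists n; exact: measure_ge0. Qed.

Let lebesgue_tuple_sigma_additive n : semi_sigma_additive (lebesgue_tuple R n).
Proof.
have [mu ->] := lebesgue_tuple_exists n; exact: measure_semi_sigma_additive.
Qed.

HB.instance Definition _ n := isMeasure.Build _ _ _ (lebesgue_tuple R n)
  (@lebesgue_tuple0 n) (@lebesgue_tuple_ge0 n)
  (@lebesgue_tuple_sigma_additive n).

Let lebesgue_tuple_sigma_finite n : sigma_finite setT (lebesgue_tuple R n).
Proof. by have [mu ->] := lebesgue_tuple_exists n; exact: sigma_finiteT. Qed.

HB.instance Definition _ n := Measure_isSigmaFinite.Build _ _ _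
  (lebesgue_tuple R n) (@lebesgue_tuple_sigma_finite n).

Lemma lebesgue_tuple_box n (A : 'I_n -> set RR) :
  (forall i, measurable (A i)) ->
  lebesgue_tuple R n [set y | forall i, A i (tnth y i)] =
  \prod_(i < n) lebesgue_measure (A i).
Proof.
elim: n A => [|n IH] A mA.
  by rewrite /= big_ord0 diracE mem_set// => -[].
rewrite /= /pushforward -/(@cons_tuple n) box_cons big_ord_recl -IH//.
rewrite product_measure1E//.
exact: (@measurable_box n (fun i => A (lift ord0 i))).
Qed.


End lebesgue_tuple.

(* simplex_integral t F n [:: s_1; ...; s_k] is
   int_{s_k}^t ds_{k+1} ... int_{s_{k+n-1}}^t ds_{k+n} F [:: s_1; ...; s_{k+n}],
   where s_0 = 0. *)
Fixpoint simplex_integral (R : realType) (t : R) (F : seq R -> \bar R)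
    (n : nat) (s : seq R) : \bar R :=
  if n is m.+1 then
    (\int[lebesgue_measure]_(u in `[last 0%R s, t])
       @simplex_integral R t F m (rcons s u))%E
  else F s.

(* The lists 0 :: s and 0 :: y provide s_0 = 0 and y_0 = 0, so that
   s`_i - (0 :: s)`_i is s_{i+1} - s_i. *)
Definition I1_integrand (R : realType) (b : R -> R) (n : nat)
    (s : seq R) (y : n.-tuple R) : R :=
  (\prod_(i < n) b (tnth y i)) *
  \prod_(i < n) derive1 (heat_kernel (s`_i - (0 :: s)`_i))
                  (y`_i - (0 :: val y)`_i).

(* I1 is extended real valued, so that an upper bound by a real number on its
   absolute value is not satisfied by default when the integral diverges. *)
Definition I1 (R : realType) (b : R -> R) (n : nat) (t : R) : \bar R :=
  simplex_integral t
    (fun s => \int[lebesgue_tuple R n]_y (I1_integrand b s y)%:E)%E n [::].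

(* Main.v *)
Require Import Defs.
From mathcomp Require Import all_boot all_order all_algebra.
From mathcomp Require Import all_classical all_reals all_analysis.
From mathcomp Require Import measurable_realfun ring lra.

Import Order.TTheory GRing.Theory Num.Theory.
Import numFieldNormedType.Exports.

Local Open Scope classical_set_scope.
Local Open Scope ring_scope.

(** Despite the oscillating sign of [q'], the bound only uses absolute values.
    The kernel [q_s'] has [L^1] norm [sqrt (2 / pi) / sqrt s], because
    [q_s] increases up to [0] and decreases afterwards, so that its total
    variation is [2 * q_s 0]. Integrating out [y_n], ..., [y_1] in turn
    therefore bounds the space integral by
    [(|b| * sqrt (2 / pi)) ^ n * \prod_i (s_i - s_(i-1)) ^ (-1/2)]
    ([integral_chain_prod_le], [integral_abs_derive1_heat_kernel]).

    What remains is a Dirichlet integral over the simplex of times. It is done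
    one variable at a time, each step being an integral
    [int_l^t (u - l) ^ (-1/2) (t - u) ^ (m / 2) du]. The exact value
    involves Beta functions at half integers, but only an upper bound is
    wanted: for odd [m] one factor [sqrt (t - u)] is bounded by
    [sqrt (t - l)], which leaves [(t - u) ^ j] with [j = [m / 2]], a polynomial
    after the substitution [w = sqrt (u - l)], and
    [int_l^t (u - l) ^ (-1/2) (t - u) ^ j du
     <= 2 / sqrt (j + 1) * (t - l) ^ (j + 1/2)] ([abel_integral_le]). Two
    consecutive steps with the same [j] contribute [4 / (j + 1)], so that [n]
    steps give at most [2 ^ n / [n/2]!] ([simplex_const_le]).

    The resulting constant [2 * sqrt (2 / pi)] per step is at most
    [2 * sqrt pi / sqrt e], since this amounts to [2 * e <= pi ^ 2], and
    [e <= 4], [8 <= pi ^ 2] ([heat_chain_constant_le]). *)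

(** * Integrals of dominated functions *)

(** The integral of a nonnegative function, measurable or not, is a supremum
    over the simple functions below it, hence monotone. The bounds below can
    thus pass through the nested integrals over [s_1, ..., s_n] with no study of
    how the inner integrals depend on the outer variables. *)
Lemma ge0_le_lower_integral d (T : measurableType d) (R : realType)
    (mu : {measure set T -> \bar R}) (D : set T) (f g : T -> \bar R) :
  (forall x, D x -> 0 <= f x)%E -> (forall x, D x -> f x <= g x)%E ->
  (\int[mu]_(x in D) f x <= \int[mu]_(x in D) g x)%E.
Proof.
move=> f0 fg; have g0 x : D x -> (0 <= g x)%E.
  by move=> Dx; exact: le_trans (f0 _ Dx) (fg _ Dx).
rewrite !ge0_integralE//; apply: le_ereal_sup => _ [h hf <-].
exists h => // x; apply: le_trans (hf x) _.
by apply: lee_restrict.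
Qed.

(** The positive and the negative part of [f] both have an integral in
    [[0, \int g]], so their difference is at most [\int g] in absolute value,
    including when some of these values are infinite. *)
Lemma abse_integral_le d (T : measurableType d) (R : realType)
    (mu : {measure set T -> \bar R}) (D : set T) (f g : T -> \bar R) :
  (forall x, D x -> `|f x| <= g x)%E ->
  (`|\int[mu]_(x in D) f x| <= \int[mu]_(x in D) g x)%E.
Proof.
move=> fg; rewrite integralE.
have fpos : (0 <= \int[mu]_(x in D) f^\+ x)%E by exact: integral_ge0.
have fneg : (0 <= \int[mu]_(x in D) f^\- x)%E by exact: integral_ge0.
have hp : (\int[mu]_(x in D) f^\+ x <= \int[mu]_(x in D) g x)%E.
  apply: ge0_le_lower_integral => // x Dx; apply: le_trans (fg x Dx).
  by rewrite funeposE ge_max abse_ge0 lee_abs.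
have hn : (\int[mu]_(x in D) f^\- x <= \int[mu]_(x in D) g x)%E.
  apply: ge0_le_lower_integral => // x Dx; apply: le_trans (fg x Dx).
  by rewrite funenegE ge_max abse_ge0 -abseN lee_abs.
move: fpos fneg hp hn.
move: (\int[mu]_(x in D) f^\+ x)%E (\int[mu]_(x in D) f^\- x)%E
  (\int[mu]_(x in D) g x)%E => [a| |] [b| |] [c| |]//=;
  rewrite ?leey// !lee_fin.
by move=> a0 b0 ac bc; rewrite ler_norml; lra.
Qed.

(** * Chains of translated kernels over tuples *)

Lemma measurable_tuple_nth (R : realType) n (i : nat) :
  measurable_fun [set: n.-tuple (measurableTypeR R)]
    (fun y : n.-tuple (measurableTypeR R) => y`_i : measurableTypeR R).
Proof.
have [ltin|leni] := ltnP i n; last first.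
  rewrite (_ : (fun _ => _) = cst 0); first exact: measurable_cst.
  by apply/funext => y /=; rewrite nth_default// size_tuple.
rewrite (_ : (fun _ => _) =
  (fun y : n.-tuple (measurableTypeR R) => tnth y (Ordinal ltin))).
  exact: measurable_tnth.
by apply/funext => y; rewrite (tnth_nth 0).
Qed.

Lemma measurable_chain_prod (R : realType) n (k : nat -> R -> R) (a : R) :
  (forall i, measurable_fun [set: R] (k i)) ->
  measurable_fun [set: n.-tuple (measurableTypeR R)]
    (fun y : n.-tuple (measurableTypeR R) =>
      \prod_(i < n) k i (y`_i - (a :: val y)`_i)).
Proof.
move=> mk; apply: measurable_prod => i _.
apply: measurableT_comp; first exact: mk.
apply: measurable_funB; first exact: measurable_tuple_nth.
case: i => -[|i] ? //=; exact: measurable_tuple_nth.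
Qed.

(** The bound on [\int k_i (y - c)] is uniform in the base point [c], so
    integrating the later coordinates first removes the factors one by one
    whatever the position [y_(i-1)]. In the induction the first coordinate is
    split off by Tonelli, and becomes the starting point [a] of a chain of
    length [n] with shifted kernels; hence the quantification over [a] and
    [k]. *)
Lemma integral_chain_prod_le (R : realType) n (k : nat -> R -> R)
    (C : nat -> R) (a : R) :
  (forall i, measurable_fun [set: R] (k i)) ->
  (forall i x, 0 <= k i x) ->
  (forall i c, \int[lebesgue_measure]_y (k i (y - c))%:E <= (C i)%:E)%E ->
  (\int[lebesgue_tuple R n]_y
     (\prod_(i < n) k i (y`_i - (a :: val y)`_i))%:E <=
   (\prod_(i < n) C i)%:E)%E.
Proof.
elim: n k C a => [|n IH] k C a mk k0 kC.
  under eq_integral do rewrite big_ord0.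
  by rewrite integral_cst//= diracT mule1 big_ord0.
have C0 i : 0 <= C i.
  rewrite -lee_fin; apply: le_trans (kC i 0); apply: integral_ge0 => y _.
  by rewrite lee_fin.
pose G (y : n.+1.-tuple (measurableTypeR R)) :=
  (\prod_(i < n.+1) k i (y`_i - (a :: val y)`_i))%:E : \bar R.
have mG : measurable_fun setT G.
  by apply/measurable_EFinP; exact: measurable_chain_prod.
have G0 y : (0 <= G y)%E by rewrite lee_fin; apply: prodr_ge0 => i _.
pose cons2 (p : measurableTypeR R * n.-tuple (measurableTypeR R)) :
  n.+1.-tuple (measurableTypeR R) := [tuple of p.1 :: p.2].
have mc : measurable_fun setT cons2 by exact: measurable_cons.
have -> : (\int[lebesgue_tuple R n.+1]_y G y =
    \int[lebesgue_measure \x lebesgue_tuple R n]_p (G \o cons2) p)%E.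
  by rewrite -[RHS](@ge0_integral_pushforward _ _ _ _ _ _ mc
    (lebesgue_measure \x lebesgue_tuple R n)%E setT)//.
rewrite fubini_tonelli1;
  [|exact: (measurableT_comp mG mc)|by move=> p; exact: G0].
rewrite /fubini_F/= big_ord_recl EFinM.
under eq_integral => x _.
  under eq_integral => y _.
    rewrite /G /cons2 big_ord_recl EFinM/=.
    over.
  over.
have mP x : measurable_fun setT (fun y : n.-tuple (measurableTypeR R) =>
    (\prod_(i < n) k i.+1 (y`_i - (x :: val y)`_i))%:E).
  apply/measurable_EFinP.
  by apply: (measurable_chain_prod _ _ (fun i => k i.+1)).
apply: (@le_trans _ _ (\int[lebesgue_measure]_x
    ((\prod_(i < n) C i.+1)%:E * (k 0%N (x - a))%:E))%E).
  apply: ge0_le_lower_integral => x _.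
    apply: integral_ge0 => y _; rewrite mule_ge0// lee_fin//.
    by apply: prodr_ge0 => i _.
  rewrite ge0_integralZl//.
  - rewrite muleC lee_wpmul2r ?lee_fin//.
    by apply: (IH (fun i => k i.+1) (fun i => C i.+1)).
  - by move=> y _; rewrite lee_fin; apply: prodr_ge0 => i _.
  - by rewrite lee_fin.
rewrite ge0_integralZl//.
- by rewrite muleC lee_wpmul2r// lee_fin; apply: prodr_ge0 => i _.
- apply/measurable_EFinP; apply: measurableT_comp; first exact: mk.
  exact: measurable_funB.
- by move=> x _; rewrite lee_fin.
- by rewrite lee_fin; apply: prodr_ge0 => i _.
Qed.

(** * The space derivative of the heat kernel *)

(** The weight [x ^ (-1/2)], with value [0] for [x <= 0]. With the same
    conventions [heat_kernel s] vanishes for [s <= 0], so the estimates in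
    terms of [inv_sqrt] hold for all times, ordered or not. *)
Definition inv_sqrt {R : realType} (x : R) : R := (Num.sqrt x)^-1.

Lemma inv_sqrt_ge0 (R : realType) (x : R) : 0 <= inv_sqrt x.
Proof. by rewrite invr_ge0 sqrtr_ge0. Qed.

Section heat_kernel_derivative.
Context {R : realType}.
Local Notation mu := (@lebesgue_measure R).

Lemma heat_kernel_le0 (s : R) : s <= 0 -> heat_kernel s = cst 0.
Proof.
move=> s0; apply/funext => x; rewrite /heat_kernel ler0_sqrtr ?invr0 ?mulr0//.
by have := pi_gt0 R; nra.
Qed.

Lemma is_derive_heat_kernel (s x : R) :
  is_derive x 1 (heat_kernel s) (- (x / s) * heat_kernel s x).
Proof.
have [s0|s0] := leP s 0.
  rewrite heat_kernel_le0// mulr0; exact: is_derive_cst.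
pose g (y : R) := - (y ^+ 2 / (2 * s)).
have dg : is_derive x 1 g (- (x / s)).
  rewrite /g; apply: is_derive_eq.
  rewrite /GRing.scale/=; field.
  by rewrite gt_eqF.
have dh := is_derive1_comp (is_derive_expR (g x)) dg.
rewrite (_ : heat_kernel s =
  (Num.sqrt (2 * pi * s))^-1 \*: (expR \o g)); last first.
  by apply/funext => y; rewrite /heat_kernel /GRing.scale/= mulrC.
apply: is_derive_eq; rewrite /= /g /GRing.scale/=; ring.
Qed.

Lemma derive1_heat_kernel (s x : R) :
  derive1 (heat_kernel s) x = - (x / s) * heat_kernel s x.
Proof.
by rewrite derive1E; apply: derive_val; exact: is_derive_heat_kernel.
Qed.

Lemma continuous_heat_kernel (s : R) : continuous (heat_kernel s).
Proof.
move=> x; apply: differentiable_continuous; apply/derivable1_diffP.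
by have [] := is_derive_heat_kernel s x.
Qed.

Lemma continuous_derive1_heat_kernel (s : R) :
  continuous (derive1 (heat_kernel s)).
Proof.
rewrite (_ : derive1 _ = (fun x => - (x / s) * heat_kernel s x)); last first.
  by apply/funext => x; exact: derive1_heat_kernel.
move=> x; apply: cvgM; last exact: continuous_heat_kernel.
by apply: cvgN; apply: cvgMl; exact: cvg_id.
Qed.

Lemma cvg_heat_kernel (s : R) : heat_kernel s x @[x --> +oo] --> (0 : R).
Proof.
have [s0|s0] := leP s 0; first by rewrite heat_kernel_le0//; exact: cvg_cst.
rewrite -(mul0r (Num.sqrt (2 * pi * s))^-1).
apply: cvgMl.
apply: (cvg_comp (fun x => x ^+ 2 / (2 * s)) (fun x => expR (- x))); last first.
  exact: cvgr_expR.
apply: gt0_cvgMly; last exact: cvgr_expr2.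
by rewrite invr_gt0 mulr_gt0.
Qed.

(** The total variation of [q_s]: after a translation, evenness reduces to the
    half line [[0, +oo[], on which [- q_s'] is nonnegative and has
    primitive [- q_s], which gives [2 * q_s 0]. *)
Lemma integral_abs_derive1_heat_kernel (s c : R) :
  (\int[mu]_y `|derive1 (heat_kernel s) (y - c)|%:E =
   (Num.sqrt (2 / pi) * inv_sqrt s)%:E)%E.
Proof.
set f : R -> R := derive1 (heat_kernel s).
have cf : continuous (fun y => `|f y|).
  move=> y; apply: cvg_norm; exact: continuous_derive1_heat_kernel.
have dsh : (fun y : R => y - c)^`()%classic = cst 1.
  apply/funext => y; rewrite derive1E.
  exact: (@derive_val _ _ _ _ _ _ _ (is_derive_shift y 1 (- c))).
have -> : (\int[mu]_y `|f (y - c)|%:E = \int[mu]_y `|f y|%:E)%E.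
  rewrite (@increasing_ge0_integration_by_substitutionT R (fun y => y - c)
    (fun y => `|f y|))//.
  - by apply: eq_integral => y _; rewrite dsh/= fctE mulr1.
  - by move=> x y xy; rewrite ltrD2r.
  - by rewrite dsh; exact: cst_continuous.
  - by rewrite dsh; exact: is_cvg_cst.
  - by rewrite dsh; exact: is_cvg_cst.
  - exact: cvg_addrr_Ny.
  - exact: cvg_addrr.
rewrite ge0_symfun_integralT//; last first.
  move=> y /=; rewrite /f !derive1_heat_kernel /heat_kernel sqrrN.
  by rewrite !mulNr !normrN.
rewrite -set_itvcy.
have [s0|s0] := leP s 0.
  rewrite integral0_eq ?mule0; last first.
    move=> y _.
    by rewrite /f derive1_heat_kernel heat_kernel_le0// mulr0 normr0.
  by rewrite /inv_sqrt (ler0_sqrtr s0) invr0 mulr0.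
have Dq (y : R) : is_derive y 1 (- heat_kernel s) ((y / s) * heat_kernel s y).
  have := is_derive_heat_kernel s y => h.
  by apply: is_derive_eq; rewrite mulNr opprK.
rewrite (@ge0_continuous_FTC2y R (fun y => `|f y|) (- heat_kernel s) 0 0)//.
- rewrite sub0e -EFinN opprK /heat_kernel expr0n mul0r oppr0 expR0 mul1r.
  rewrite -EFinM /inv_sqrt; congr EFin.
  rewrite !sqrtrM ?mulr_ge0// ?pi_ge0// sqrtrV ?pi_ge0//.
  have p0 : Num.sqrt (pi : R) != 0 by rewrite gt_eqF// sqrtr_gt0 pi_gt0.
  have q0 : Num.sqrt s != 0 by rewrite gt_eqF// sqrtr_gt0.
  have r0 : Num.sqrt (2 : R) != 0 by rewrite gt_eqF// sqrtr_gt0.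
  rewrite -{1}(@sqr_sqrtr R 2)//; field.
  by rewrite p0 q0 r0.
- exact: continuous_subspaceT.
- rewrite -oppr0; apply: cvgN; exact: cvg_heat_kernel.
- apply: cvg_at_right_filter; apply: cvgN; exact: continuous_heat_kernel.
- move=> y; rewrite in_itv/= andbT => y0; rewrite derive1E.
  rewrite (@derive_val _ _ _ _ _ _ _ (Dq y)) /f derive1_heat_kernel.
  rewrite mulNr normrN ger0_norm// mulr_ge0// ?divr_ge0//; exact: ltW.
Qed.
End heat_kernel_derivative.

(** * The integral of an inverse square root against a power *)

(** The primitive in [w], vanishing at [0], of [2 * (T - w ^ 2) ^ j]. The
    recursion comes from differentiating [w * (T - w ^ 2) ^ (k + 1)] and
    writing [w ^ 2 = T - (T - w ^ 2)]. *)
Fixpoint beta_primitive {R : realType} (T : R) (j : nat) (w : R) : R :=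
  if j is k.+1 then
    (2 * k.+1%:R * T * beta_primitive T k w + 2 * (w * (T - w ^+ 2) ^+ k.+1)) /
    (2 * k.+1%:R + 1)
  else 2 * w.

Section abel_kernel_integral.
Context {R : realType}.
Local Notation mu := (@lebesgue_measure R).

Lemma is_derive_beta_primitive (T : R) j (w : R) :
  is_derive w 1 (beta_primitive T j) (2 * (T - w ^+ 2) ^+ j).
Proof.
elim: j => [|j IH] /=.
  apply: is_derive_eq; rewrite /GRing.scale/=; ring.
pose g (w : R) := w * (T - w ^+ 2) ^+ j.+1.
have dg : is_derive w 1 g ((T - w ^+ 2) ^+ j.+1 -
    2 * j.+1%:R * w ^+ 2 * (T - w ^+ 2) ^+ j).
  rewrite (_ : g = (id : R -> R) *
    (cst T - (id : R -> R) ^+ 2) ^+ j.+1); last first.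
    by apply/funext => x; rewrite /g !fctE.
  apply: is_derive_eq; rewrite /GRing.scale/= !fctE; ring.
pose c : R := (2 * j.+1%:R + 1)^-1.
rewrite (_ : (fun w => _) = c \*: ((2 * j.+1%:R * T) \*: beta_primitive T j
   + 2 \*: g)); last first.
  apply/funext => x; rewrite /c /g /GRing.scale/= !fctE/= /GRing.scale/=.
  by rewrite mulrC.
apply: is_derive_eq; rewrite /GRing.scale/= /c !(exprS (T - w ^+ 2)); field.
by rewrite gt_eqF.
Qed.

Lemma beta_primitive_ge0 (T : R) j (w : R) : 0 <= T -> 0 <= w -> w ^+ 2 <= T ->
  0 <= beta_primitive T j w.
Proof.
move=> T0 w0 wT; elim: j => [|j IH] /=; first by rewrite mulr_ge0.
by rewrite divr_ge0// addr_ge0// ?mulr_ge0// exprn_ge0// subr_ge0.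
Qed.

(** At [w ^ 2 = T] the recursion reduces to a factor
    [(2 * k + 2) / (2 * k + 3) * T], and
    [(2 * k + 2) ^ 2 * (k + 2) <= (2 * k + 3) ^ 2 * (k + 1)] propagates the
    bound. *)
Lemma beta_primitive_le (r : R) j : 0 <= r ->
  beta_primitive (r ^+ 2) j r <=
  2 / Num.sqrt j.+1%:R * r ^+ (2 * j).+1.
Proof.
move=> r0; elim: j => [|j IH] /=.
  by rewrite sqrtr1 divr1 muln0 expr1.
rewrite subrr expr0n/= !mulr0 addr0.
have j1 : 0 < j.+1%:R :> R by [].
rewrite (_ : (2 * j.+1).+1 = (2 * j).+1 + 2)%N; last first.
  by rewrite mulnS addnC addSn.
rewrite exprD.
set a := Num.sqrt (j.+1%:R : R); set b := Num.sqrt (j.+2%:R : R).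
have a0 : 0 < a by rewrite sqrtr_gt0.
have b0 : 0 < b by rewrite sqrtr_gt0.
have a2 : a ^+ 2 = j.+1%:R by rewrite sqr_sqrtr.
have b2 : b ^+ 2 = j.+1%:R + 1 by rewrite sqr_sqrtr// natr1.
set B := beta_primitive _ _ _ in IH *.
have d0 : 0 < 2 * j.+1%:R + 1 :> R by lra.
rewrite ler_pdivrMr//.
apply: (@le_trans _ _ (2 * j.+1%:R * r ^+ 2 * (2 / a * r ^+ (2 * j).+1))).
  by apply: ler_wpM2l => //; rewrite !mulr_ge0.
set P := r ^+ (2 * j).+1; have P0 : 0 <= P by rewrite exprn_ge0.
have -> : 2 * j.+1%:R * r ^+ 2 * (2 / a * P) =
  (2 * P * r ^+ 2) * (2 * j.+1%:R / a) by field; rewrite gt_eqF.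
have -> : 2 / b * (P * r ^+ 2) * (2 * j.+1%:R + 1) =
  (2 * P * r ^+ 2) * ((2 * j.+1%:R + 1) / b) by field; rewrite gt_eqF.
apply: ler_wpM2l; first by rewrite !mulr_ge0// exprn_ge0.
rewrite -a2 expr2 mulrA mulfK ?gt_eqF//.
rewrite ler_pdivlMr//.
nra.
Qed.

(** The power function of exponent [-1] composed with the square root; the two
    agree on [x <= 0] as well, where both are [0]. *)
Lemma measurable_inv_sqrt : measurable_fun [set: R] inv_sqrt.
Proof.
rewrite (_ : inv_sqrt = (@powR R ^~ (-1)) \o Num.sqrt); last first.
  by apply/funext => x; rewrite /inv_sqrt/= powR_inv1// sqrtr_ge0.
apply: measurableT_comp; first exact: measurable_powR.
apply: continuous_measurable_fun => x; exact: sqrt_continuous.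
Qed.

Lemma measurable_abel_integrand (l t : R) j :
  measurable_fun [set: R] (fun u => inv_sqrt (u - l) * (t - u) ^+ j).
Proof.
apply: measurable_funM.
  by apply: measurableT_comp;
      [exact: measurable_inv_sqrt|exact: measurable_funB].
by apply: measurable_funX; exact: measurable_funB.
Qed.

(** The substitution [w = sqrt (u - l)] in the form of a primitive. *)
Lemma is_derive_beta_primitive_sqrt (l t u : R) j : l < u ->
  is_derive u 1 (fun x => beta_primitive (t - l) j (Num.sqrt (x - l)))
    (inv_sqrt (u - l) * (t - u) ^+ j).
Proof.
move=> lu; have ul0 : 0 < u - l by rewrite subr_gt0.
have ds : is_derive u 1 (Num.sqrt \o shift (- l)) ((2 * Num.sqrt (u - l))^-1).
  have := @is_derive1_comp R Num.sqrt (shift (- l)) u _ 1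
    (is_derive1_sqrt ul0) (is_derive_shift u 1 (- l)).
  by rewrite mulr1.
have := is_derive1_comp (is_derive_beta_primitive (t - l) j _) ds.
rewrite /= sqr_sqrtr ?(ltW ul0)//.
rewrite (_ : t - l - (u - l) = t - u); last by ring.
rewrite (_ : 2 * _ / _ = inv_sqrt (u - l) * (t - u) ^+ j)//.
rewrite /inv_sqrt; field.
by rewrite gt_eqF// sqrtr_gt0.
Qed.

(** On [[a, t]] with [l < a] the integrand is continuous, and the primitive is
    nonnegative at [a], hence a bound that persists as [a] tends to [l]. *)
Lemma abel_integral_away_le (l t a : R) j : l < a -> a <= t ->
  (\int[mu]_(u in `[a, t]) (inv_sqrt (u - l) * (t - u) ^+ j)%:E <=
   (beta_primitive (t - l) j (Num.sqrt (t - l)))%:E)%E.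
Proof.
move=> la at_; have lt_ : l < t := lt_le_trans la at_.
have F0 x : l <= x -> x <= t ->
    0 <= beta_primitive (t - l) j (Num.sqrt (x - l)).
  move=> lx xt; apply: beta_primitive_ge0.
  - by rewrite subr_ge0 (le_trans lx).
  - exact: sqrtr_ge0.
  - by rewrite sqr_sqrtr ?subr_ge0// lerD2r.
move: at_; rewrite le_eqVlt => /predU1P[->|at_].
  by rewrite set_itv1 integral_set1 lee_fin F0// ltW.
have dF (x : R) : l < x -> is_derive x 1
    (fun x => beta_primitive (t - l) j (Num.sqrt (x - l)))
    (inv_sqrt (x - l) * (t - x) ^+ j).
  exact: is_derive_beta_primitive_sqrt.
have cF (x : R) : l < x -> {for x, continuous
    (fun x => beta_primitive (t - l) j (Num.sqrt (x - l)))}.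
  move=> lx; apply: differentiable_continuous; apply/derivable1_diffP.
  by have [] := dF x lx.
rewrite (@continuous_FTC2 R _
  (fun x => beta_primitive (t - l) j (Num.sqrt (x - l))))//.
- rewrite -EFinB lee_fin lerBlDr lerDl F0//; exact: ltW.
- apply: continuous_in_subspaceT => x; rewrite inE/= in_itv/= => /andP[ax _].
  apply: cvgM.
    apply: cvgV; first by rewrite gt_eqF// sqrtr_gt0 subr_gt0 (lt_le_trans la).
    apply: (continuous_comp (f := fun x => x - l)); last exact: sqrt_continuous.
    by apply: cvgB; [exact: cvg_id|exact: cvg_cst].
  apply: (continuous_comp (f := fun x => t - x) (g := fun x => x ^+ j)).
    by apply: cvgB; [exact: cvg_cst|exact: cvg_id].
  exact: exprn_continuous.
- split.
  + move=> x; rewrite in_itv/= => /andP[ax _].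
    by have [] := dF x (lt_trans la ax).
  + by apply: cvg_at_right_filter; exact: cF.
  + by apply: cvg_at_left_filter; apply: cF; exact: lt_trans at_.
- move=> x; rewrite in_itv/= => /andP[ax _].
  by rewrite derive1E (@derive_val _ _ _ _ _ _ _ (dF x (lt_trans la ax))).
Qed.

(** The singularity at [l] is reached by monotone convergence along the
    intervals [[l + 1 / (n + 1), t]]. *)
Lemma abel_integral_le (l t : R) j : l <= t ->
  (\int[mu]_(u in `[l, t]) (inv_sqrt (u - l) * (t - u) ^+ j)%:E <=
   (2 / Num.sqrt j.+1%:R * Num.sqrt (t - l) ^+ (2 * j).+1)%:E)%E.
Proof.
move=> lt_; set f := fun u => _%:E.
have mf : measurable_fun setT f.
  by apply/measurable_EFinP; exact: measurable_abel_integrand.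
rewrite -integral_itv_obnd_cbnd; last exact: measurable_funTS.
rewrite itv_open_bnd_bigcup.
have f0 (u : R) : u <= t -> (0 <= f u)%E.
  by move=> ut; rewrite lee_fin mulr_ge0 ?inv_sqrt_ge0// exprn_ge0// subr_ge0.
pose F n : set R := `[l + n.+1%:R^-1, t]%classic.
have cv : (\int[mu]_(u in F n) f u @[n --> \oo] -->
    \int[mu]_(u in \bigcup_n F n) f u)%E.
  apply: ge0_nondecreasing_set_cvg_integral.
  - move=> m n mn; apply/subsetPset; apply: subset_itvr.
    by rewrite bnd_simp lerD2l lef_pV2 ?posrE// ler_nat.
  - by move=> n; exact: measurable_itv.
  - by move=> n; exact: measurable_funTS.
  - by move=> n u; rewrite /F/= in_itv/= => /andP[_]; exact: f0.
rewrite -(cvg_lim _ cv)//; apply: lime_le.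
  by apply/cvg_ex; eexists; exact: cv.
apply: nearW => n.
apply: (@le_trans _ _ (beta_primitive (t - l) j (Num.sqrt (t - l)))%:E).
  have [at_|ta] := leP (l + n.+1%:R^-1) t.
    by apply: abel_integral_away_le => //; rewrite ltrDl invr_gt0.
  rewrite /F set_itv_ge ?integral_set0; last by rewrite bnd_simp -ltNge.
  rewrite lee_fin beta_primitive_ge0 ?subr_ge0 ?sqrtr_ge0//.
  by rewrite sqr_sqrtr// subr_ge0.
rewrite lee_fin -{1}(@sqr_sqrtr _ (t - l)) ?subr_ge0//.
by apply: beta_primitive_le; exact: sqrtr_ge0.
Qed.

End abel_kernel_integral.

(** * Iterated integrals over the simplex of times *)

Section simplex_bound.
Context {R : realType}.
Local Notation mu := (@lebesgue_measure R).

(** The product of the factors [2 / sqrt ([i / 2] + 1)] over [i < m]: the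
    factors of index [2 * j] and [2 * j + 1] multiply to [4 / (j + 1)], and for
    odd [m] the last factor is unpaired. *)
Definition simplex_const (m : nat) : R :=
  2 ^+ m / ((m./2)`!%:R * Num.sqrt (m./2).+1%:R ^+ odd m).

Lemma simplex_const_ge0 m : 0 <= simplex_const m.
Proof. by rewrite divr_ge0 ?exprn_ge0// mulr_ge0// exprn_ge0// sqrtr_ge0. Qed.

Lemma simplex_constS m :
  simplex_const m.+1 = simplex_const m * (2 / Num.sqrt (m./2).+1%:R).
Proof.
rewrite /simplex_const -[m.+1./2]/(uphalf m) uphalf_half exprS/=.
set j := m./2.
have s0 : Num.sqrt (j.+1%:R : R) != 0 by rewrite gt_eqF// sqrtr_gt0.
have f0 : (j`!%:R : R) != 0 by rewrite pnatr_eq0 -lt0n fact_gt0.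
case: (odd m) => /=; rewrite ?add0n ?add1n ?expr1 ?expr0; last first.
  by field; rewrite f0 s0.
rewrite factS natrM; set q := Num.sqrt _ in s0 *.
have -> : (j.+1%:R : R) = q ^+ 2 by rewrite sqr_sqrtr.
by field; rewrite f0 s0.
Qed.

Lemma simplex_const_le m : simplex_const m <= 2 ^+ m / (m./2)`!%:R.
Proof.
rewrite /simplex_const ler_wpM2l ?exprn_ge0//.
have f0 : 0 < ((m./2)`!%:R : R) by rewrite ltr0n fact_gt0.
rewrite lef_pV2 ?posrE// ?mulr_gt0 ?exprn_gt0 ?sqrtr_gt0//.
rewrite ler_peMr ?(ltW f0)// exprn_ege1//.
by rewrite -{1}(sqrtr1 R) ler_wsqrtr// ler1n.
Qed.

(** With [j = [m / 2]], the power [sqrt (t - u) ^ m] is [(t - u) ^ j] when [m]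
    is even, and at most [(t - u) ^ j * sqrt (t - l)] when [m] is odd. *)
Lemma abel_integral_half_power_le (l t : R) m : l <= t ->
  (\int[mu]_(u in `[l, t])
     (inv_sqrt (u - l) * (simplex_const m * Num.sqrt (t - u) ^+ m))%:E <=
   (simplex_const m.+1 * Num.sqrt (t - l) ^+ m.+1)%:E)%E.
Proof.
move=> lt_; set j := m./2; set c := simplex_const m * Num.sqrt (t - l) ^+ odd m.
have c0 : 0 <= c by rewrite mulr_ge0 ?simplex_const_ge0// exprn_ge0// sqrtr_ge0.
apply: (@le_trans _ _ (\int[mu]_(u in `[l, t])
    (c%:E * (inv_sqrt (u - l) * (t - u) ^+ j)%:E))%E).
  apply: ge0_le_lower_integral => u /=; rewrite in_itv/= => /andP[lu ut].
    by rewrite lee_fin mulr_ge0 ?inv_sqrt_ge0// mulr_ge0 ?simplex_const_ge0.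
  rewrite -EFinM lee_fin /c.
  move: (simplex_const m) (simplex_const_ge0 m) => d d0.
  rewrite mulrCA -[leRHS]mulrA ler_wpM2l// [leRHS]mulrCA.
  rewrite ler_wpM2l ?inv_sqrt_ge0//.
  rewrite -{1}(odd_double_half m) -/j exprD -mul2n exprM sqr_sqrtr ?subr_ge0//.
  rewrite ler_wpM2r ?exprn_ge0 ?subr_ge0//.
  by rewrite lerXn2r ?nnegrE ?sqrtr_ge0// ler_wsqrtr// lerD2l lerN2.
rewrite ge0_integralZl//.
- apply: (@le_trans _ _ (c%:E *
    (2 / Num.sqrt j.+1%:R * Num.sqrt (t - l) ^+ (2 * j).+1)%:E)%E).
    by rewrite lee_wpmul2l ?lee_fin//; exact: abel_integral_le.
  rewrite -EFinM lee_fin simplex_constS -/j /c mulrACA -exprD addnS mul2n.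
  by rewrite odd_double_half.
- by apply/measurable_EFinP/measurable_funTS; exact: measurable_abel_integrand.
- move=> u /=; rewrite in_itv/= => /andP[lu ut].
  by rewrite lee_fin mulr_ge0 ?inv_sqrt_ge0// exprn_ge0// subr_ge0.
Qed.

Definition abel_weight (s : seq R) : R :=
  \prod_(i < size s) inv_sqrt (s`_i - (0 :: s)`_i).

Lemma abel_weight_ge0 s : 0 <= abel_weight s.
Proof. by apply: prodr_ge0 => i _; exact: inv_sqrt_ge0. Qed.

Lemma abel_weight_rcons s u :
  abel_weight (rcons s u) = abel_weight s * inv_sqrt (u - last 0 s).
Proof.
rewrite /abel_weight size_rcons big_ord_recr/= nth_rcons ltnn eqxx.
rewrite -rcons_cons nth_rcons/= ltnS leqnn (last_nth 0).
congr (_ * _); apply: eq_bigr => i _.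
by rewrite nth_rcons ltn_ord -rcons_cons nth_rcons/= ltnS ltnW.
Qed.

(** Induction on the number [m] of variables still to be integrated: the
    innermost integrals of the weight contribute
    [simplex_const m * (t - s_k) ^ (m / 2)], where [s_k] is the last time in
    [s], and the next integral in [s_k] against [(s_k - s_(k-1)) ^ (-1/2)] is
    the one-variable estimate above. *)
Lemma simplex_integral_le (t : R) (F : seq R -> \bar R) (K : R) n : 0 <= K ->
  (forall s, size s = n -> (`|F s| <= (K * abel_weight s)%:E)%E) ->
  forall m s, (size s + m)%N = n -> last 0 s <= t ->
  (`|simplex_integral t F m s| <=
   (K * abel_weight s *
    (simplex_const m * Num.sqrt (t - last 0%R s) ^+ m))%:E)%E.
Proof.
move=> K0 FK; elim=> [|m IH] s sn lst /=.
  rewrite /simplex_const/= fact0 !expr0 !mulr1 divr1 mulr1.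
  by apply: FK; rewrite -sn addn0.
set l := last 0 s in lst *.
have Ks0 : 0 <= K * abel_weight s by rewrite mulr_ge0// abel_weight_ge0.
have Sge0 u : 0 <= simplex_const m * Num.sqrt (t - u) ^+ m.
  by rewrite mulr_ge0 ?simplex_const_ge0// exprn_ge0// sqrtr_ge0.
apply: (@le_trans _ _ (\int[mu]_(u in `[l, t]) ((K * abel_weight s)%:E *
   (inv_sqrt (u - l) * (simplex_const m * Num.sqrt (t - u) ^+ m))%:E))%E).
  apply: abse_integral_le => u /=; rewrite in_itv/= => /andP[lu ut].
  apply: (le_trans (IH (rcons s u) _ _)).
  - by rewrite size_rcons addSnnS.
  - by rewrite last_rcons.
  - by rewrite last_rcons abel_weight_rcons -/l -EFinM !mulrA.
rewrite ge0_integralZl//.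
- rewrite [leRHS]EFinM lee_wpmul2l ?lee_fin//.
  exact: abel_integral_half_power_le.
- apply/measurable_EFinP/measurable_funTS; apply: measurable_funM.
    by apply: measurableT_comp;
      [exact: measurable_inv_sqrt|exact: measurable_funB].
  apply: measurable_funM; first exact: measurable_cst.
  apply: measurable_funX; apply: measurableT_comp; last exact: measurable_funB.
  by apply: continuous_measurable_fun => x; exact: sqrt_continuous.
- by move=> u _; rewrite lee_fin mulr_ge0 ?inv_sqrt_ge0.
Qed.

End simplex_bound.

(** * Numerical constants *)

Lemma sin_le (R : realType) (x : R) : 0 <= x -> sin x <= x.
Proof.
rewrite le_eqVlt => /predU1P[<-|x0]; first by rewrite sin0.
have [c _] := @MVT R (@sin R) (@cos R) 0 x x0
  (fun y _ => is_derive_sin y) (continuous_subspaceT (@continuous_sin R)).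
rewrite sin0 !subr0 => ->; rewrite ler_piMl ?cos_le1//; exact: ltW.
Qed.

(** [sin (pi / 4) = 1 / sqrt 2], and [sin (pi / 4) <= pi / 4]. *)
Lemma pi_sqr_ge8 (R : realType) : 8 <= (pi : R) ^+ 2.
Proof.
have h : cos ((pi : R) / 4 + pi / 4) = 0.
  by rewrite -mulrDl -(cos_pihalf R); congr cos; field.
have p0 := pi_gt0 R.
have s0 : 0 <= sin ((pi : R) / 4).
  by apply: sin_ge0_pi; apply/andP; split; lra.
have sl : sin ((pi : R) / 4) <= pi / 4 by apply: sin_le; lra.
move: h; rewrite cosD => h; have := cos2Dsin2 ((pi : R) / 4); nra.
Qed.

(** [expR (- 1/2) >= 1 - 1/2], to be squared. *)
Lemma expR1_le4 (R : realType) : expR 1 <= 4 :> R.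
Proof.
have h := expR_ge1Dx (- (1 / 2) : R).
have -> : (1 : R) = (1 / 2) + (1 / 2) by lra.
have h2 : expR (- (1/2)) * expR (1/2) = 1 :> R by rewrite mulrC expRxMexpNx_1.
have := expR_gt0 (1/2 : R); rewrite expRD; nra.
Qed.

(** The left-hand side is the price of one time step, the [L^1] norm of the
    kernel times the factor [2] of [simplex_const_le]. *)
Lemma heat_chain_constant_le (R : realType) :
  Num.sqrt (2 / pi) * 2 <= 2 * Num.sqrt pi / Num.sqrt (expR 1) :> R.
Proof.
have p0 := pi_gt0 R; have e0 := expR_gt0 (1 : R).
rewrite mulrC -mulrA ler_pM2l// -[in leRHS]sqrtrV ?(ltW e0)//.
rewrite -sqrtrM ?(ltW p0)// ler_wsqrtr// ler_pdivrMr// mulrAC ler_pdivlMr//.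
rewrite -expr2; apply: le_trans (pi_sqr_ge8 R).
have := expR1_le4 R; lra.
Qed.

(** * The bound on the iterated integral *)

Lemma norm_le_sup_norm (R : realType) (b : R -> R) (x : R) :
  bounded_fun b -> `|b x| <= sup_norm b.
Proof.
case=> M [_ /(_ (M + 1))]; rewrite ltrDl => /(_ ltr01) bM.
apply: sup_upper_bound; last by exists x.
split; first by exists `|b 0|; exists 0.
by exists (M + 1) => _ [y _ <-]; exact: bM.
Qed.

(** The factors [b (y_i)] are bounded by the sup norm; the remaining product is
    the chain of the kernels [|q_(s_i - s_(i-1))'|] started at [y_0 = 0]. *)
Lemma abse_integral_I1_integrand_le (R : realType) (b : R -> R) n (s : seq R) :
  bounded_fun b -> size s = n ->
  (`|\int[lebesgue_tuple R n]_y (I1_integrand b s y)%:E| <=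
   ((sup_norm b * Num.sqrt (2 / pi)) ^+ n * abel_weight s)%:E)%E.
Proof.
move=> bb sn; set M := sup_norm b; set C := Num.sqrt (2 / pi).
have M0 : 0 <= M by apply: le_trans (norm_le_sup_norm R b 0 bb).
pose k i x := `|derive1 (heat_kernel (s`_i - (0 :: s)`_i)) x|.
have mk i : measurable_fun [set: R] (k i).
  apply: continuous_measurable_fun => x; apply: cvg_norm.
  exact: continuous_derive1_heat_kernel.
apply: (@le_trans _ _ (\int[lebesgue_tuple R n]_y ((M ^+ n)%:E *
    (\prod_(i < n) k i (y`_i - (0 :: val y)`_i))%:E))%E).
  apply: abse_integral_le => y _.
  rewrite -EFinM lee_fin /I1_integrand normrM ler_pM//.
    rewrite normr_prod -[n in leRHS]card_ord -prodr_const.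
    by apply: ler_prod => i _; rewrite normr_ge0 norm_le_sup_norm.
  by rewrite normr_prod.
rewrite ge0_integralZl//.
- rewrite exprMn -mulrA EFinM lee_wpmul2l ?lee_fin ?exprn_ge0//.
  rewrite /abel_weight sn -[n in C ^+ n]card_ord -prodr_const -big_split/=.
  apply: (integral_chain_prod_le R n k
    (fun i => C * inv_sqrt (s`_i - (0 :: s)`_i))) => // i c.
    exact: normr_ge0.
  by rewrite integral_abs_derive1_heat_kernel.
- by apply/measurable_EFinP; exact: measurable_chain_prod.
- by move=> y _; rewrite lee_fin; apply: prodr_ge0 => i _; exact: normr_ge0.
- by rewrite lee_fin exprn_ge0.
Qed.

Theorem proposition5p2 (R : realType) (b : R -> R)
    (mb : measurable_fun [set: R] b) (bb : bounded_fun b)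
    (n : nat) (n_ge1 : (1 <= n)%N) (t : R) (t_gt0 : 0 < t) :
  (`| I1 b n t | <=
    ((2 * Num.sqrt pi) ^+ n / (Num.sqrt (expR 1) ^+ n * (n./2)`!%:R) *
     sup_norm b ^+ n * t `^ (n%:R / 2))%:E)%E.
Proof.
set M := sup_norm b; set C : R := Num.sqrt (2 / pi).
have M0 : 0 <= M by apply: le_trans (norm_le_sup_norm R b 0 bb).
have C0 : 0 <= C by exact: sqrtr_ge0.
have f0 : 0 < ((n./2)`!%:R : R) by rewrite ltr0n fact_gt0.
have K0 : 0 <= (M * C) ^+ n by rewrite exprn_ge0// mulr_ge0.
apply: le_trans (simplex_integral_le t _ _ n K0
  (fun s => abse_integral_I1_integrand_le R b n s bb) n [::] _ (ltW t_gt0)) _.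
  by [].
rewrite /abel_weight/= big_ord0 mulr1 subr0 lee_fin.
have -> : t `^ (n%:R / 2) = Num.sqrt t ^+ n.
  by rewrite mulrC powRrM powR12_sqrt ?(ltW t_gt0)// powR_mulrn ?sqrtr_ge0.
rewrite mulrA ler_wpM2r ?exprn_ge0 ?sqrtr_ge0//.
apply: (@le_trans _ _ ((M * C) ^+ n * (2 ^+ n / (n./2)`!%:R))).
  by rewrite ler_wpM2l// simplex_const_le.
rewrite exprMn -[leLHS]mulrA [leRHS]mulrC ler_wpM2l ?exprn_ge0//.
rewrite invfM !mulrA ler_wpM2r ?invr_ge0 ?(ltW f0)//.
rewrite -exprVn -!exprMn lerXn2r ?nnegrE ?mulr_ge0 ?invr_ge0 ?sqrtr_ge0//.
exact: heat_chain_constant_le.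
Qed.
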